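(* Each generatrix of $\Sigma^+$ and $\Sigma^-$ is contained in one $1$-sheeted hyperboloid oriented along the $y$-axis from the confocal family $(\mathcal{Q}_\lambda)$. Moreover, such a generatrix is touching at the same point one of the tropic curves of the hyperboloid and one of the cusp-like edges of the corresponding curved tetrahedron ($\mathcal{T}^+$ for $\Sigma^+$, $\mathcal{T}^-$ for $\Sigma^-$).
   Context: The three-dimensional Minkowski space $\mathbf{E}^{2,1}$ is $\mathbf{R}^3$ with coordinates $(x,y,z)$ and scalar product $\langle u,w\rangle=u_1w_1+u_2w_2-u_3w_3$. Fix constants $a>b>0$, $c>0$. The confocal family is $$\mathcal{Q}_\lambda:\ \frac{x^2}{a-\lambda}+\frac{y^2}{b-\lambda}+\frac{z^2}{c+\lambda}=1,\qquad\lambda\in\mathbf{R};$$ the $1$-sheeted hyperboloids oriented along the $y$-axis are the $\mathcal{Q}_\lambda$ with $\lambda\in(b,a)$. The tropic curves on $\mathcal{Q}_\lambda$ are the set of its points where the metric induced by $\langle\cdot,\cdot\rangle$ on the tangent plane is degenerate. The union of all tropic curves of the family is $\Sigma^+\cup\Sigma^-$, where $$\Sigma^\pm:\quad x=\frac{a-\lambda}{\sqrt{a+c}}\cos t,\quad y=\frac{b-\lambda}{\sqrt{b+c}}\sin t,\quad z=\pm(c+\lambda)\sqrt{\frac{\cos^2t}{a+c}+\frac{\sin^2t}{b+c}},\qquad\lambda\in\mathbf{R},\ t\in[0,2\pi),$$ $\lambda$ being the parameter of the quadric. The generatrices of $\Sigma^\pm$ are the straight lines obtained by fixing $t$ and varying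 $\lambda$. The curved tetrahedron $\mathcal{T}^\pm$ is the subset of $\Sigma^\pm$ given by $\lambda\in[b,a]$; its four cusp-like (cuspidal) edges are the curves on $\Sigma^\pm$ given by $-a-b+2\lambda+(a-b)\cos2t=0$.
   Formalization: The four generatrices of each of Σ⁺ and Σ⁻ with sin t cos t = 0 (in the planes x = 0 or y = 0) are excluded: they lie on no 1-sheeted hyperboloid Q_λ with λ in (b,a), so the claim fails for them as stated. *)

(* Defs.v *)
From HB Require Import structures.
From mathcomp Require Import all_boot all_order all_algebra.
From mathcomp Require Import all_classical all_reals all_analysis.
From mathcomp Require Import ring lra.

Set Implicit Arguments.
Unset Strict Implicit.
Unset Printing Implicit Defensive.

Import Order.TTheory GRing.Theory Num.Theory.
Import numFieldNormedType.Exports.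

Local Open Scope classical_set_scope.
Local Open Scope ring_scope.

Definition vec3 (R : realType) (x y z : R) : 'rV[R]_3 :=
  \row_(i < 3) [:: x; y; z]`_i.

Definition minkowski_dot (R : realType) (u w : 'rV[R]_3) : R :=
  u 0 0 * w 0 0 + u 0 1 * w 0 1 - u 0 2 * w 0 2.

Definition confocal_fun (R : realType) (a b c l : R) (p : 'rV[R]_3) : R :=
  p 0 0 ^+ 2 / (a - l) + p 0 1 ^+ 2 / (b - l) + p 0 2 ^+ 2 / (c + l).

(* Division by zero is total: this is the quadric Q_l only when l is none of
   a, b, - c. *)
Definition confocal (R : realType) (a b c l : R) : set 'rV[R]_3 :=
  [set p | confocal_fun a b c l p = 1].

Definition hyperboloid_y (R : realType) (a b l : R) : Prop := b < l < a.

Definition tangent_plane (R : realType) (a b c l : R) (p : 'rV[R]_3) :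
    set 'rV[R]_3 :=
  [set v | 'D_v (confocal_fun a b c l) p = 0].

Definition degenerate_on (R : realType) (V : set 'rV[R]_3) : Prop :=
  exists v, [/\ V v, v != 0 & forall w, V w -> minkowski_dot v w = 0].

Definition tropic_set (R : realType) (a b c l : R) : set 'rV[R]_3 :=
  [set p | confocal a b c l p /\ degenerate_on (tangent_plane a b c l p)].

(* The individual tropic curves are the connected components of the tropic
   set. *)
Definition tropic_curve (R : realType) (a b c l : R) (K : set 'rV[R]_3) :
    Prop :=
  exists2 p, tropic_set a b c l p & K = connected_component (tropic_set a b c l) p.

(* The parametrization of Sigma^+ (s = false) and Sigma^- (s = true). *)
Definition Sigma (R : realType) (a b c : R) (s : bool) (l t : R) : 'rV[R]_3 :=
  vec3 ((a - l) / Num.sqrt (a + c) * cos t)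
       ((b - l) / Num.sqrt (b + c) * sin t)
       ((-1) ^+ s * (c + l) *
          Num.sqrt (cos t ^+ 2 / (a + c) + sin t ^+ 2 / (b + c))).

Definition generatrix (R : realType) (a b c : R) (s : bool) (t : R) :
    set 'rV[R]_3 :=
  [set Sigma a b c s l t | l in [set: R]].

(* On Sigma^{+/-} the equation - a - b + 2 l + (a - b) cos 2t = 0 describes one
   closed curve, with cusps where sin 2t = 0 (the vertices of the tetrahedron).
   These cut it into the four edges, numbered by the quadrant of t; the bounds
   on l place them on the tetrahedron. *)
Definition cuspidal_edge (R : realType) (a b c : R) (s : bool) (k : 'I_4) :
    set 'rV[R]_3 :=
  [set p | exists l t,
    [/\ b <= l <= a,
        k%:R * (pi / 2) <= t <= k.+1%:R * (pi / 2),
        - a - b + 2 * l + (a - b) * cos (2 * t) = 0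
      & p = Sigma a b c s l t]].

(* L is the tangent line of C at p, i.e. the limit of the secants of C through
   p: the distance from q in C to L is o(|q - p|) as q tends to p. *)
Definition touches (R : realType) (L C : set 'rV[R]_3) (p : 'rV[R]_3) : Prop :=
  [/\ C p, limit_point C p &
      exists v : 'rV[R]_3,
        [/\ v != 0, L = [set p + r *: v | r in [set: R]] &
            forall e : R, 0 < e -> \forall q \near p,
              C q -> exists r : R, `|q - (p + r *: v)| <= e * `|q - p|]].

Lemma Sigma_confocal (R : realType) (a b c : R) (s : bool) (l m t : R) :
  0 < b -> b < a -> 0 < c ->
  confocal_fun a b c m (Sigma a b c s l t) =
  (a - l) ^+ 2 / (a + c) * cos t ^+ 2 / (a - m) +
  (b - l) ^+ 2 / (b + c) * sin t ^+ 2 / (b - m) +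
  (c + l) ^+ 2 * (cos t ^+ 2 / (a + c) + sin t ^+ 2 / (b + c)) / (c + m).
Proof.
move=> b0 ba c0; have ac : 0 < a + c by lra.
have bc : 0 < b + c by lra.
rewrite /confocal_fun /Sigma /vec3 !mxE /=.
have s0 : 0 <= cos t ^+ 2 / (a + c) + sin t ^+ 2 / (b + c).
  by rewrite addr_ge0 // divr_ge0 ?sqr_ge0 ?ltW.
by rewrite !exprMn !exprVn sqrr_sign mul1r !sqr_sqrtr ?(ltW ac) ?(ltW bc).
Qed.

(* The four generatrices in the coordinate planes x = 0 and y = 0 lie on no
   hyperboloid of the family, hence the nondegeneracy hypothesis on t in the
   main statement. *)
Lemma exceptional_generatrix (R : realType) (a b c : R) (s : bool) (t m : R) :
  0 < b -> b < a -> 0 < c -> cos t * sin t = 0 -> hyperboloid_y a b m ->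
  ~ generatrix a b c s t `<=` confocal a b c m.
Proof.
move=> b0 ba c0 cs0 /andP[bm ma] sub.
have ac : a + c != 0 by lra.
have bc : b + c != 0 by lra.
have cm : c + m != 0 by lra.
have am : a - m != 0 by lra.
have bm0 : b - m != 0 by lra.
have cs1 := cos2Dsin2 t.
have E l : confocal_fun a b c m (Sigma a b c s l t) = 1.
  by apply: sub; exists l.
move/eqP: cs0; rewrite mulf_eq0 => /orP[] /eqP z0.
- have := E b; rewrite Sigma_confocal //.
  move: cs1; rewrite z0 !expr0n /= add0r => ->.
  rewrite subrr expr0n /= => H.
  have H1 : (b + c) / (c + m) = 1 by rewrite -H; field; rewrite ac bc cm am bm0.
  have : b + c = c + m by rewrite -[RHS]mul1r -H1 divfK.
  by move=> ?; lra.
- have := E a; rewrite Sigma_confocal //.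
  move: cs1; rewrite z0 !expr0n /= addr0 => ->.
  rewrite subrr expr0n /= => H.
  have H1 : (a + c) / (c + m) = 1 by rewrite -H; field; rewrite ac bc cm am bm0.
  have : a + c = c + m by rewrite -[RHS]mul1r -H1 divfK.
  by move=> ?; lra.
Qed.

(* Main.v *)
Require Import Defs.
From HB Require Import structures.
From mathcomp Require Import all_boot all_order all_algebra.
From mathcomp Require Import all_classical all_reals all_analysis.
From mathcomp Require Import ring lra.

Import Order.TTheory GRing.Theory Num.Theory.
Import numFieldNormedType.Exports.

Local Open Scope classical_set_scope.
Local Open Scope ring_scope.

(* The gradient N = (X, Y, Z) of half the equation of Q_m at a tropic point is
   lightlike, and the tropic points of all the quadrics are
   ((a - m) X, (b - m) Y, (c + m) Z) with N on the single curve
   (a + c) X^2 + (b + c) Y^2 = 1, Z^2 = X^2 + Y^2; a generatrix is obtained by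
   fixing N and varying m.  On the line of N, the equation of Q_m has a double
   root at the parameter m, so the line lies in Q_m exactly when the remaining
   coefficient vanishes, i.e. m = b (a + c) X^2 + a (b + c) Y^2.  For that m the
   coefficients a - m, b - m, c + m are constant multiples k_i of X^2, Y^2, Z^2.
   So, along the curve of the N', the tropic curve of Q_m is
   (k_0 X^2 X', k_1 Y^2 Y', k_2 Z^2 Z') and the cuspidal edges are
   (k_0 X'^3, k_1 Y'^3, k_2 Z'^3).  At N' = N the velocities of the two curves
   are proportional, with ratio 1 : 3, and parallel to (-X, -Y, Z), which is the
   direction of the generatrix. *)

(** * Coordinates, norm and continuity in three-space *)

Lemma vec3_eta (R : realType) (p : 'rV[R]_3) :
  p = vec3 (p 0 0) (p 0 1) (p 0 2).
Proof.
apply/rowP => i; rewrite mxE.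
case: i => [[|[|[|//]]] i3] /=; congr (p _ _); exact: val_inj.
Qed.

Lemma vec3_inj (R : realType) (x y z x' y' z' : R) :
  vec3 x y z = vec3 x' y' z' -> [/\ x = x', y = y' & z = z'].
Proof.
by move=> /rowP E; split; [move: (E 0)|move: (E 1)|move: (E 2)]; rewrite !mxE.
Qed.

Lemma vec3_add (R : realType) (x y z x' y' z' : R) :
  vec3 x y z + vec3 x' y' z' = vec3 (x + x') (y + y') (z + z').
Proof. by rewrite [LHS]vec3_eta !mxE. Qed.

Lemma vec3_scale (R : realType) (r x y z : R) :
  r *: vec3 x y z = vec3 (r * x) (r * y) (r * z).
Proof. by rewrite [LHS]vec3_eta !mxE. Qed.

Lemma vec3_sub (R : realType) (x y z x' y' z' : R) :
  vec3 x y z - vec3 x' y' z' = vec3 (x - x') (y - y') (z - z').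
Proof. by rewrite [LHS]vec3_eta !mxE. Qed.

Lemma coord_norm_le (R : realType) (p : 'rV[R]_3) (i : 'I_3) : `|p 0 i| <= `|p|.
Proof.
rewrite [leRHS]/Num.Def.normr /= mx_normrE.
by apply/bigmax_geP; right => /=; exists (0, i).
Qed.

Lemma vec3_norm_le (R : realType) (x y z M : R) :
  `|x| <= M -> `|y| <= M -> `|z| <= M -> `|vec3 x y z| <= M.
Proof.
move=> xM yM zM; rewrite [leLHS]/Num.Def.normr /= mx_normrE.
apply: bigmax_le => [|[i j] _ /=]; first exact: le_trans xM.
by rewrite mxE; case: j => [[|[|[|//]]] j3] /=.
Qed.

Lemma continuous_vec3 (R : realType) (f g h : R -> R) :
  continuous f -> continuous g -> continuous h ->
  continuous (fun u => vec3 (f u) (g u) (h u)).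
Proof.
move=> cf cg ch u.
rewrite (_ : (fun u => _) = fun u =>
   f u *: vec3 1 0 0 + g u *: vec3 0 1 0 + h u *: vec3 0 0 1); last first.
  by apply/funext => w; rewrite !vec3_scale !vec3_add; congr vec3; ring.
apply: cvgD; [apply: cvgD|]; apply: cvgZr_tmp; [exact: cf|exact: cg|exact: ch].
Qed.

(** * From metric bounds to tangency *)

(** A second-order deviation falls below any multiple of [|q - p|] as [q] tends to [p]; each
    tangency thus reduces to one estimate on the whole curve. *)
Lemma touches_of_quadratic_bound (R : realType) (C : set 'rV[R]_3)
    (p v : 'rV[R]_3) (M : R) :
  C p -> limit_point C p -> v != 0 ->
  (forall q, C q -> exists r, `|q - (p + r *: v)| <= M * `|q - p| ^+ 2) ->
  touches [set p + r *: v | r in [set: R]] C p.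
Proof.
move=> Cp lp v0 bound; split=> //; exists v; split=> // e e0.
(* [M] may be zero or negative, so [|M| + 1] serves as a positive divisor. *)
have M1 : 0 < `|M| + 1 by rewrite ltr_wpDl.
near=> q => Cq.
have [r qr] := bound q Cq; exists r; apply: le_trans qr _.
rewrite expr2 mulrA ler_wpM2r //.
have qe : `|q - p| <= e / (`|M| + 1).
  by near: q; apply: cvgr_distC_le; [exact: cvg_id|exact: divr_gt0].
apply: le_trans (_ : (`|M| + 1) * `|q - p| <= _).
  by rewrite ler_wpM2r //; have := ler_norm M; lra.
by rewrite mulrC -ler_pdivlMr.
Unshelve. all: by end_near. Qed.

(** The approach is from the right only, which suits an edge: its parameter interval is known to
    extend beyond [t] on that side. *)
Lemma limit_point_path (R : realType) (T : topologicalType) (C : set T)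
    (f : R -> T) (t e : R) :
  0 < e -> {for t, continuous f} ->
  (forall u, t < u < t + e -> C (f u) /\ f u != f t) -> limit_point C (f t).
Proof.
move=> e0 ft Cf U Ut.
have ftr : f u @[u --> t^'+] --> f t by exact: cvg_within_filter ft.
have near_t : \forall u \near t^'+, [/\ f u != f t, C (f u) & U (f u)].
  near=> u.
  have tu : t < u < t + e.
    apply/andP; split; first by near: u; exact: nbhs_right_gt.
    by near: u; apply: nbhs_right_lt; rewrite ltrDl.
  have [Cu ne] := Cf u tu; split=> //.
  near: u; exact: ftr Ut.
have [u [? ? ?]] := @filter_ex _ _ (at_right_proper_filter t) _ near_t.
by exists (f u).
Unshelve. all: by end_near. Qed.

(** * Tropic points as points with lightlike normal *)

(** [confocal_fun] is a quadratic form, so its difference quotient at step [h] is exactly the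
    right-hand side plus [h] times the form at [v]. *)
Lemma derive_confocal_fun (R : realType) (a b c m : R) (p v : 'rV[R]_3) :
  'D_v (confocal_fun a b c m) p =
  2 * (p 0 0 / (a - m) * v 0 0 + p 0 1 / (b - m) * v 0 1 +
       p 0 2 / (c + m) * v 0 2).
Proof.
set k := RHS; apply: cvg_lim => //.
have : (fun h : R => k + h * confocal_fun a b c m v) @ 0^' -->
    k + 0 * confocal_fun a b c m v.
  apply: (cvg_within_filter (F := nbhs (0 : R))).
  apply: cvgD; first exact: cvg_cst.
  by apply: cvgM; [exact: cvg_id|exact: cvg_cst].
rewrite mul0r addr0; apply: cvg_trans; apply: near_eq_cvg.
near=> h.
have h0 : h != 0 by near: h; exact: nbhs_dnbhs_neq.
rewrite /k /confocal_fun /= !mxE /GRing.scale /=.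
by apply: (mulfI h0); rewrite mulVKf //; ring.
Unshelve. all: by end_near. Qed.

(** Inserting Z^2 = X^2 + Y^2 into (a - m) X^2 + (b - m) Y^2 + (c + m) Z^2 = 1 cancels m, which is
    why one curve of normals serves all the quadrics. *)
Definition tropic_normal {R : realType} (a b c X Y Z : R) : Prop :=
  (a + c) * X ^+ 2 + (b + c) * Y ^+ 2 = 1 /\ Z ^+ 2 = X ^+ 2 + Y ^+ 2.

(** Testing a kernel vector against (Y, -X, 0), (Z, 0, -X), (0, Z, -Y), which lie in the plane,
    makes it parallel to (X, Y, -Z) when the normal is nonzero; such a vector lies in the plane only
    if the normal is lightlike. *)
Lemma lightlike_normal (R : realType) (X Y Z : R) :
  degenerate_on [set v | X * v 0 0 + Y * v 0 1 + Z * v 0 2 = 0] ->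
  Z ^+ 2 = X ^+ 2 + Y ^+ 2.
Proof.
move=> [v [/= Nv v0 deg]].
have := deg (vec3 Y (- X) 0); have := deg (vec3 Z 0 (- X)).
have := deg (vec3 0 Z (- Y)).
rewrite /minkowski_dot /= !mxE /= => /(_ ltac:(ring)) Eyz /(_ ltac:(ring)) Exz.
move=> /(_ ltac:(ring)) Exy.
apply/eqP; rewrite -subr_eq0; apply: contraNT v0 => G0.
rewrite [v]vec3_eta (_ : 0 = vec3 0 0 0); last by rewrite [LHS]vec3_eta !mxE.
move: Nv Exy Exz Eyz; set x := v 0 0; set y := v 0 1; set z := v 0 2.
move=> Nv Exy' Exz' Eyz'.
have Exy : x * Y - y * X = 0 by rewrite -Exy'; ring.
have Exz : x * Z + z * X = 0 by rewrite -Exz'; ring.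
have Eyz : y * Z + z * Y = 0 by rewrite -Eyz'; ring.
(* Each coordinate of [v] times Z^2 - X^2 - Y^2 is a combination of the four vanishing linear
   expressions. *)
have comb w u : u = 0 -> w * (Z ^+ 2 - (X ^+ 2 + Y ^+ 2)) = u -> w = 0.
  by move=> -> /eqP; rewrite mulf_eq0 (negbTE G0) orbF => /eqP.
apply/eqP; congr vec3.
- apply: (comb _ (Z * (x * Z + z * X) - X * (X * x + Y * y + Z * z) -
    Y * (x * Y - y * X))); last by ring.
  by rewrite Exy Exz Nv; ring.
- apply: (comb _ (Z * (y * Z + z * Y) - Y * (X * x + Y * y + Z * z) +
    X * (x * Y - y * X))); last by ring.
  by rewrite Exy Eyz Nv; ring.
- apply: (comb _ (Z * (X * x + Y * y + Z * z) - X * (x * Z + z * X) -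
    Y * (y * Z + z * Y))); last by ring.
  by rewrite Exz Eyz Nv; ring.
Qed.

(** The kernel vector is (X, Y, -Z): its Minkowski product with [w] is the linear form that defines
    the plane. *)
Lemma lightlike_degenerate (R : realType) (X Y Z : R) :
  Z != 0 -> Z ^+ 2 = X ^+ 2 + Y ^+ 2 ->
  degenerate_on [set v | X * v 0 0 + Y * v 0 1 + Z * v 0 2 = 0].
Proof.
move=> Z0 ZXY; exists (vec3 X Y (- Z)); split => /=.
- rewrite !mxE /=; transitivity (X ^+ 2 + Y ^+ 2 - Z ^+ 2); first by ring.
  by rewrite ZXY subrr.
- apply: contraNneq Z0 => /rowP /(_ 2).
  by rewrite !mxE /= => /eqP; rewrite oppr_eq0.
- by move=> w Nw; rewrite /minkowski_dot !mxE /= -[RHS]Nw; ring.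
Qed.

Lemma tropic_setP (R : realType) (a b c m : R) (p : 'rV[R]_3) :
  a - m != 0 -> b - m != 0 -> c + m != 0 -> 0 < a + c -> 0 < b + c ->
  tropic_set a b c m p <->
  exists X Y Z, tropic_normal a b c X Y Z /\
    p = vec3 ((a - m) * X) ((b - m) * Y) ((c + m) * Z).
Proof.
move=> am bm cm ac bc.
have planeE q : tangent_plane a b c m q = [set v | q 0 0 / (a - m) * v 0 0 +
    q 0 1 / (b - m) * v 0 1 + q 0 2 / (c + m) * v 0 2 = 0].
  apply/seteqP; split=> v; rewrite /tangent_plane /= derive_confocal_fun.
    by move/eqP; rewrite mulf_eq0 pnatr_eq0 => /eqP.
  by move=> ->; rewrite mulr0.
split.
- rewrite /tropic_set /= planeE => -[Qp /lightlike_normal Np].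
  exists (p 0 0 / (a - m)), (p 0 1 / (b - m)), (p 0 2 / (c + m)).
  split; last first.
    by rewrite [LHS]vec3_eta; congr vec3; rewrite mulrC divfK.
  split=> //; rewrite -[RHS]Qp /confocal_fun.
  set X := _ / (a - m) in Np *; set Y := _ / (b - m) in Np *.
  set Z := _ / (c + m) in Np *.
  have -> : p 0 0 = (a - m) * X by rewrite mulrC divfK.
  have -> : p 0 1 = (b - m) * Y by rewrite mulrC divfK.
  have -> : p 0 2 = (c + m) * Z by rewrite mulrC divfK.
  transitivity ((a - m) * X ^+ 2 + (b - m) * Y ^+ 2 + (c + m) * Z ^+ 2).
    by rewrite Np; ring.
  by field; rewrite am bm cm.
- move=> [X [Y [Z [[E1 E2] ->]]]].
  (* Z = 0 would force X = Y = 0, against the first equation of the curve. *)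
  have ne0 : Z != 0.
    apply/eqP => Z0; move: E2; rewrite Z0 expr0n /= => /esym/eqP.
    rewrite paddr_eq0 ?sqr_ge0 // !sqrf_eq0 => /andP[/eqP X0 /eqP Y0].
    move: E1; rewrite X0 Y0 expr0n /= !mulr0 addr0 => /eqP.
    by rewrite eq_sym oner_eq0.
  split.
    rewrite /confocal /confocal_fun /= !mxE /= -[RHS]E1.
    transitivity ((a - m) * X ^+ 2 + (b - m) * Y ^+ 2 + (c + m) * Z ^+ 2).
      by field; rewrite am bm cm.
    by rewrite E2; ring.
  rewrite planeE !mxE /= ![(_ - m) * _]mulrC [(c + m) * _]mulrC !mulfK //.
  exact: lightlike_degenerate.
Qed.

(** * Second-order estimates along the curve of normals *)

Lemma tropic_normal_bound (R : realType) (a b c X Y Z : R) :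
  0 < a + c -> 0 < b + c -> tropic_normal a b c X Y Z ->
  let K := 1 + (a + c)^-1 + (b + c)^-1 in
  [/\ `|X| <= K, `|Y| <= K & `|Z| <= K].
Proof.
move=> A0 B0 [E1 E2] /=; set K := _ + _.
have iA : 0 < (a + c)^-1 by rewrite invr_gt0.
have iB : 0 < (b + c)^-1 by rewrite invr_gt0.
(* The summand 1 in [K] gives 1 < K, so K < |w| would yield w^2 >= K > K - 1. *)
have sqr_bound (w : R) : w ^+ 2 <= K - 1 -> `|w| <= K.
  rewrite -real_normK ?num_real // => wK.
  rewrite leNgt; apply/negP => Kw.
  have K1 : 1 < K by rewrite /K; lra.
  have K0 := lt_trans ltr01 K1.
  have := ler_pM (ltW K0) ler01 (ltW Kw) (ltW (lt_trans K1 Kw)).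
  by rewrite -expr2; lra.
have sX : X ^+ 2 <= (a + c)^-1.
  rewrite -[leRHS]mulr1 ler_pdivlMl // -E1 lerDl.
  by rewrite mulr_ge0 ?sqr_ge0 // ltW.
have sY : Y ^+ 2 <= (b + c)^-1.
  rewrite -[leRHS]mulr1 ler_pdivlMl // -E1 lerDr.
  by rewrite mulr_ge0 ?sqr_ge0 // ltW.
split; apply: sqr_bound; rewrite /K ?E2; lra.
Qed.

(** The equations of the curve are quadratic, so on a secant their linear part is minus half a
    quadratic form in the increments. The estimated vectors are increments of the tropic curve minus
    a multiple of the generatrix direction. *)
Lemma tropic_normal_secant (R : realType) (a b c X0 Y0 Z0 X Y Z e : R) :
  0 < a + c -> 0 < b + c -> b < a ->
  tropic_normal a b c X0 Y0 Z0 -> tropic_normal a b c X Y Z ->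
  `|X - X0| <= e -> `|Y - Y0| <= e -> `|Z - Z0| <= e ->
  let M := (a + c) ^+ 2 * (`|X0| + `|Y0| + `|Z0|) in
  exists r,
  [/\ `|(a - b) * (a + c) * X0 ^+ 2 * (X - X0) - r * - X0| <= M * e ^+ 2,
      `|- (a - b) * (b + c) * Y0 ^+ 2 * (Y - Y0) - r * - Y0| <= M * e ^+ 2
    & `|(a + c) * (b + c) * Z0 ^+ 2 * (Z - Z0) - r * Z0| <= M * e ^+ 2].
Proof.
move=> A0 B0 ba [E1 E2] [F1 F2] He1 He2 He3 M.
have sqr_le (w : R) : `|w| <= e -> w ^+ 2 <= e ^+ 2.
  move=> we; rewrite -real_normK ?num_real //.
  by rewrite lerXn2r ?nnegrE // (le_trans _ we).
have := sqr_le _ He1; have := sqr_le _ He2; have := sqr_le _ He3.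
move=> {sqr_le He1 He2 He3}; set A := a + c in A0 E1 F1 M *.
set B := b + c in B0 E1 F1 *.
have -> : a - b = A - B by rewrite /A /B; ring.
have BA : B < A by rewrite /A /B; lra.
move=> eZ eY eX.
have E0 : 0 <= e ^+ 2 by apply: sqr_ge0.
(* Common shape of the two remainders; all coefficients are at most A, the larger of A and B. *)
have bound (k w k1 k2 u v : R) : `|k| <= A -> `|w| <= `|X0| + `|Y0| + `|Z0| ->
    0 <= k1 <= A -> 0 <= k2 <= A -> 0 <= u <= e ^+ 2 -> 0 <= v <= e ^+ 2 ->
    `|k * w * (k1 * u + k2 * v) / 2| <= M * e ^+ 2.
  move=> kA wM /andP[? ?] /andP[? ?] /andP[? ?] /andP[? ?].
  rewrite 3!normrM [`|2^-1|]gtr0_norm ?invr_gt0 // ler_pdivrMr //.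
  rewrite [`|_ + _|]ger0_norm ?addr_ge0 ?mulr_ge0 //.
  have -> : M * e ^+ 2 * 2 = A * (`|X0| + `|Y0| + `|Z0|) *
    (A * e ^+ 2 + A * e ^+ 2) by rewrite /M; ring.
  by rewrite ler_pM ?addr_ge0 ?mulr_ge0 ?lerD ?ler_pM.
have nD : `|A - B| <= A by rewrite gtr0_norm; lra.
have nA : `|- A| <= A by rewrite normrN gtr0_norm.
have [[nX nY] nZ] := (normr_ge0 X0, normr_ge0 Y0, normr_ge0 Z0).
(* This [r] makes the first coordinate vanish; the other two become linear parts of A X^2 + B Y^2 =
   1 and of its consequence B Z^2 + (A - B) X^2 = 1. *)
exists (- (A - B) * A * X0 * (X - X0)); split.
- rewrite (_ : _ - _ = 0); last by ring.
  by rewrite normr0 mulr_ge0 // mulr_ge0 ?sqr_ge0 ?addr_ge0.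
- rewrite (_ : _ - _ = (A - B) * Y0 *
      (A * (X - X0) ^+ 2 + B * (Y - Y0) ^+ 2) / 2); last first.
    apply/eqP; rewrite -subr_eq0; apply/eqP.
    transitivity ((A - B) * Y0 / 2 * ((A * X0 ^+ 2 + B * Y0 ^+ 2) -
      (A * X ^+ 2 + B * Y ^+ 2))); first by field.
    by rewrite E1 F1 subrr mulr0.
  by apply: bound; rewrite ?sqr_ge0 //; lra.
- rewrite (_ : _ - _ = - A * Z0 *
      (B * (Z - Z0) ^+ 2 + (A - B) * (X - X0) ^+ 2) / 2); last first.
    apply/eqP; rewrite -subr_eq0; apply/eqP.
    transitivity (A * Z0 / 2 * (B * (Z ^+ 2 - (X ^+ 2 + Y ^+ 2)) -
      B * (Z0 ^+ 2 - (X0 ^+ 2 + Y0 ^+ 2)) +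
      ((A * X ^+ 2 + B * Y ^+ 2) - (A * X0 ^+ 2 + B * Y0 ^+ 2)))).
      by field.
    by rewrite E1 F1 E2 F2 !subrr; ring.
  by apply: bound; rewrite ?sqr_ge0 //; lra.
Qed.

(** Cubing does not contract too much away from 0, so a displacement along the edge controls the
    increment of the normal. *)
Lemma cube_dist_ge (R : realFieldType) (x y : R) :
  x ^+ 2 * `|y - x| <= 2 * `|y ^+ 3 - x ^+ 3|.
Proof.
have -> : y ^+ 3 - x ^+ 3 = (y ^+ 2 + x * y + x ^+ 2) * (y - x) by ring.
rewrite normrM mulrA ler_wpM2r //.
have le2 : x ^+ 2 <= 2 * (y ^+ 2 + x * y + x ^+ 2).
  rewrite -subr_ge0.
  have -> : 2 * (y ^+ 2 + x * y + x ^+ 2) - x ^+ 2 = y ^+ 2 + (x + y) ^+ 2.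
    by ring.
  by rewrite addr_ge0 ?sqr_ge0.
by apply: le_trans le2 _; rewrite ler_pM2l // ler_norm.
Qed.

Lemma tropic_normal_cube_secant (R : realType) (a b c X0 Y0 Z0 : R) :
  0 < a + c -> 0 < b + c -> b < a -> tropic_normal a b c X0 Y0 Z0 ->
  exists M, forall X Y Z e, tropic_normal a b c X Y Z ->
  `|X - X0| <= e -> `|Y - Y0| <= e -> `|Z - Z0| <= e ->
  exists r,
  [/\ `|(a - b) * (a + c) * (X ^+ 3 - X0 ^+ 3) - r * - X0| <= M * e ^+ 2,
      `|- (a - b) * (b + c) * (Y ^+ 3 - Y0 ^+ 3) - r * - Y0| <= M * e ^+ 2
    & `|(a + c) * (b + c) * (Z ^+ 3 - Z0 ^+ 3) - r * Z0| <= M * e ^+ 2].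
Proof.
move=> A0 B0 ba N0; pose K := 1 + (a + c)^-1 + (b + c)^-1.
(* From w^3 - w0^3 = 3 w0^2 (w - w0) + (w + 2 w0) (w - w0)^2: three times the bound for the tropic
   curve, plus a term with |w + 2 w0| <= 3 K. *)
pose M := 3 * ((a + c) ^+ 2 * (`|X0| + `|Y0| + `|Z0|)) + (a + c) ^+ 2 * (3 * K).
exists M => X Y Z e N He1 He2 He3.
have [X0K Y0K Z0K] := tropic_normal_bound _ _ _ _ _ _ _ A0 B0 N0.
have [XK YK ZK] := tropic_normal_bound _ _ _ _ _ _ _ A0 B0 N.
have [r [H1 H2 H3]] :=
  tropic_normal_secant _ _ _ _ _ _ _ _ _ _ _ A0 B0 ba N0 N He1 He2 He3.
have cube (k w w0 v : R) : `|k| <= (a + c) ^+ 2 -> `|w| <= K -> `|w0| <= K ->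
    `|w - w0| <= e ->
    `|k * w0 ^+ 2 * (w - w0) - r * v| <=
      (a + c) ^+ 2 * (`|X0| + `|Y0| + `|Z0|) * e ^+ 2 ->
    `|k * (w ^+ 3 - w0 ^+ 3) - 3 * r * v| <= M * e ^+ 2.
  move=> kA wK w0K we lin.
  have -> : k * (w ^+ 3 - w0 ^+ 3) - 3 * r * v =
    3 * (k * w0 ^+ 2 * (w - w0) - r * v) + k * (w + w0 + w0) * (w - w0) ^+ 2.
    by ring.
  rewrite /M [leRHS]mulrDl; apply: le_trans (ler_normD _ _) _; apply: lerD.
    by rewrite normrM normr_nat -[leRHS]mulrA ler_pM2l.
  rewrite !normrM ler_pM ?mulr_ge0 //.
    rewrite ler_pM //; apply: le_trans (ler_normD _ _) _.
    by have := ler_normD w w0; lra.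
  by rewrite [leRHS]expr2 ler_pM.
by exists (3 * r); split; apply: cube => //;
   rewrite ?mulNr ?normrN ger0_norm ?mulr_ge0 ?expr2 ?ler_pM //; lra.
Qed.

(** * The quadric containing a given generatrix *)

(** In the expansion in powers of l - m, the constant term is 1 and the linear term is a multiple of
    Z^2 - X^2 - Y^2, hence zero. *)
Lemma confocal_on_line (R : realType) (a b c m l X Y Z : R) :
  a - m != 0 -> b - m != 0 -> c + m != 0 -> tropic_normal a b c X Y Z ->
  confocal_fun a b c m (vec3 ((a - l) * X) ((b - l) * Y) ((c + l) * Z)) =
  1 + (l - m) ^+ 2 * (b * (a + c) * X ^+ 2 + a * (b + c) * Y ^+ 2 - m) /
    ((a - m) * (b - m) * (c + m)).
Proof.
move=> am bm cm [E1 E2]; rewrite /confocal_fun !mxE /= !exprMn E2.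
have -> : b * (a + c) * X ^+ 2 + a * (b + c) * Y ^+ 2 - m =
    (a + c) * X ^+ 2 * (b - m) + (b + c) * Y ^+ 2 * (a - m).
  by rewrite -[in LHS](mulr1 m) -E1; ring.
by rewrite -[in RHS]E1; field; rewrite am bm cm.
Qed.

(** [m] is the mean of [b] and [a] with weights (a + c) X^2 and (b + c) Y^2, whose sum is 1. *)
Lemma tropic_normal_param (R : realType) (a b c X Y Z : R) :
  tropic_normal a b c X Y Z ->
  let m := b * (a + c) * X ^+ 2 + a * (b + c) * Y ^+ 2 in
  [/\ a - m = (a - b) * (a + c) * X ^+ 2, b - m = - (a - b) * (b + c) * Y ^+ 2
    & c + m = (a + c) * (b + c) * Z ^+ 2].
Proof.
move=> [E1 E2] m; split.
- by rewrite -[X in X - _]mulr1 -E1 /m; ring.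
- by rewrite -[X in X - _]mulr1 -E1 /m; ring.
- by rewrite -[X in X + _]mulr1 -E1 E2 /m; ring.
Qed.

Lemma tropic_normal_param_bounds (R : realType) (a b c X Y Z : R) :
  0 < a + c -> 0 < b + c -> b < a -> X != 0 -> Y != 0 ->
  tropic_normal a b c X Y Z ->
  b < b * (a + c) * X ^+ 2 + a * (b + c) * Y ^+ 2 < a.
Proof.
move=> A0 B0 ba X0 Y0 /tropic_normal_param[am bm _].
have pX : 0 < (a - b) * (a + c) * X ^+ 2.
  by rewrite mulr_gt0 ?exprn_even_gt0 // mulr_gt0 ?subr_gt0.
have pY : 0 < (a - b) * (b + c) * Y ^+ 2.
  by rewrite mulr_gt0 ?exprn_even_gt0 // mulr_gt0 ?subr_gt0.
by move: pX pY bm; rewrite !mulNr -am => *; lra.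
Qed.

Lemma tropic_scales_neq0 (R : realType) (a b c X Y Z : R) :
  0 < a + c -> 0 < b + c -> b < a -> X != 0 -> Y != 0 -> Z != 0 ->
  [/\ (a - b) * (a + c) * X ^+ 2 != 0, - (a - b) * (b + c) * Y ^+ 2 != 0
    & (a + c) * (b + c) * Z ^+ 2 != 0].
Proof.
move=> A0 B0 ba X0 Y0 Z0.
have [nA nB nD] : [/\ a + c != 0, b + c != 0 & a - b != 0] by split; lra.
by split; rewrite mulf_neq0 ?expf_neq0 // mulf_neq0 ?oppr_eq0.
Qed.

(** * Quadratic deviation of the two curves from the generatrix *)

(** Turns the displacement of a point into bounds for the increments of its normal. The factor 2 is
    that of [cube_dist_ge]; for the tropic curve it is slack. *)
Lemma coord_increments_le (R : realType) (w0 w1 w2 : R) :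
  w0 != 0 -> w1 != 0 -> w2 != 0 ->
  exists k : R, forall (d : 'rV[R]_3) (u0 u1 u2 : R),
    `|w0| * `|u0| <= 2 * `|d 0 0| -> `|w1| * `|u1| <= 2 * `|d 0 1| ->
    `|w2| * `|u2| <= 2 * `|d 0 2| ->
    [/\ `|u0| <= k * `|d|, `|u1| <= k * `|d| & `|u2| <= k * `|d|].
Proof.
move=> n0 n1 n2; exists (2 * (`|w0|^-1 + `|w1|^-1 + `|w2|^-1)).
move=> d u0 u1 u2 H0 H1 H2.
have [[p0 p1] p2] : (0 < `|w0|^-1) * (0 < `|w1|^-1) * (0 < `|w2|^-1).
  by rewrite !invr_gt0 !normr_gt0.
have le (w u : R) (i : 'I_3) : w != 0 -> `|w| * `|u| <= 2 * `|d 0 i| ->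
    `|w|^-1 <= `|w0|^-1 + `|w1|^-1 + `|w2|^-1 ->
    `|u| <= 2 * (`|w0|^-1 + `|w1|^-1 + `|w2|^-1) * `|d|.
  move=> w_neq0 wu wk.
  apply: le_trans (_ : 2 * `|w|^-1 * `|d| <= _); last first.
    by rewrite ler_wpM2r // ler_pM2l.
  rewrite mulrAC ler_pdivlMr ?normr_gt0 // mulrC.
  by apply: le_trans wu _; rewrite ler_pM2l // coord_norm_le.
by split; [apply: le H0 _|apply: le H1 _|apply: le H2 _] => //; lra.
Qed.

Lemma tropic_quadratic_bound (R : realType) (a b c X Y Z : R) :
  0 < a + c -> 0 < b + c -> b < a -> X != 0 -> Y != 0 -> Z != 0 ->
  tropic_normal a b c X Y Z ->
  let m := b * (a + c) * X ^+ 2 + a * (b + c) * Y ^+ 2 in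
  let p := vec3 ((a - m) * X) ((b - m) * Y) ((c + m) * Z) in
  exists M, forall U V W, tropic_normal a b c U V W ->
  let q := vec3 ((a - m) * U) ((b - m) * V) ((c + m) * W) in
  exists r, `|q - (p + r *: vec3 (- X) (- Y) Z)| <= M * `|q - p| ^+ 2.
Proof.
move=> A0 B0 ba X0 Y0 Z0 N m p.
have [am bm cm] := tropic_normal_param _ _ _ _ _ _ _ N; rewrite -/m in am bm cm.
have [am0 bm0 cm0] := tropic_scales_neq0 _ _ _ _ _ _ _ A0 B0 ba X0 Y0 Z0.
rewrite -am -bm -cm in am0 bm0 cm0.
have [k kle] := coord_increments_le _ _ _ _ am0 bm0 cm0.
exists ((a + c) ^+ 2 * (`|X| + `|Y| + `|Z|) * k ^+ 2) => U V W N' q.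
have dq : q - p =
    vec3 ((a - m) * (U - X)) ((b - m) * (V - Y)) ((c + m) * (W - Z)).
  by rewrite /q /p vec3_sub; congr vec3; ring.
have [||| kU kV kW] := kle (q - p) (U - X) (V - Y) (W - Z).
- by rewrite -normrM dq !mxE /= ler_peMl // ler1n.
- by rewrite -normrM dq !mxE /= ler_peMl // ler1n.
- by rewrite -normrM dq !mxE /= ler_peMl // ler1n.
(* The secant estimate is used with e = k |q - p|, whence the factor k^2 in the constant. *)
have [r] :=
  tropic_normal_secant _ _ _ _ _ _ _ _ _ _ _ A0 B0 ba N N' kU kV kW.
rewrite -am -bm -cm => -[H1 H2 H3].
exists r; rewrite [X in `|X| <= _](_ : _ = vec3 ((a - m) * (U - X) - r * - X)
  ((b - m) * (V - Y) - r * - Y) ((c + m) * (W - Z) - r * Z)).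
  by rewrite -[leRHS]mulrA -exprMn; exact: vec3_norm_le.
by rewrite opprD addrA dq vec3_scale vec3_sub.
Qed.

Lemma edge_quadratic_bound (R : realType) (a b c X Y Z : R) :
  0 < a + c -> 0 < b + c -> b < a -> X != 0 -> Y != 0 -> Z != 0 ->
  tropic_normal a b c X Y Z ->
  let edge X Y Z := vec3 ((a - b) * (a + c) * X ^+ 3)
    (- (a - b) * (b + c) * Y ^+ 3) ((a + c) * (b + c) * Z ^+ 3) in
  let p := edge X Y Z in
  exists M, forall U V W, tropic_normal a b c U V W ->
  exists r, `|edge U V W - (p + r *: vec3 (- X) (- Y) Z)| <=
            M * `|edge U V W - p| ^+ 2.
Proof.
move=> A0 B0 ba X0 Y0 Z0 N edge p.
have [am0 bm0 cm0] := tropic_scales_neq0 _ _ _ _ _ _ _ A0 B0 ba X0 Y0 Z0.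
have [k kle] := coord_increments_le _ _ _ _ am0 bm0 cm0.
have [M cubeM] := tropic_normal_cube_secant _ _ _ _ _ _ _ A0 B0 ba N.
exists (M * k ^+ 2) => U V W N'.
have dq : edge U V W - p = vec3 ((a - b) * (a + c) * (U ^+ 3 - X ^+ 3))
    (- (a - b) * (b + c) * (V ^+ 3 - Y ^+ 3))
    ((a + c) * (b + c) * (W ^+ 3 - Z ^+ 3)).
  by rewrite vec3_sub; congr vec3; ring.
have cube (w x y : R) :
    `|w * x ^+ 2| * `|y - x| <= 2 * `|w * (y ^+ 3 - x ^+ 3)|.
  rewrite normrM [`|w * (_ - _)|]normrM -[leLHS]mulrA [leRHS]mulrCA.
  rewrite ler_wpM2l //.
  by rewrite (ger0_norm (sqr_ge0 _)) cube_dist_ge.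
have [||| kU kV kW] := kle (edge U V W - p) (U - X) (V - Y) (W - Z).
- by rewrite dq mxE /=; exact: cube.
- by rewrite dq mxE /=; exact: cube.
- by rewrite dq mxE /=; exact: cube.
have [r [H1 H2 H3]] := cubeM _ _ _ _ N' kU kV kW.
exists r; rewrite [X in `|X| <= _](_ : _ = vec3
  ((a - b) * (a + c) * (U ^+ 3 - X ^+ 3) - r * - X)
  (- (a - b) * (b + c) * (V ^+ 3 - Y ^+ 3) - r * - Y)
  ((a + c) * (b + c) * (W ^+ 3 - Z ^+ 3) - r * Z)); last first.
  by rewrite opprD addrA dq vec3_scale vec3_sub.
by rewrite -[leRHS]mulrA -exprMn; exact: vec3_norm_le.
Qed.

(** * Trigonometric parametrization of the normals *)

Definition normal_x {R : realType} (a c t : R) : R := cos t / Num.sqrt (a + c).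

Definition normal_y {R : realType} (b c t : R) : R := sin t / Num.sqrt (b + c).

Definition normal_z {R : realType} (a b c : R) (s : bool) (t : R) : R :=
  (-1) ^+ s * Num.sqrt (cos t ^+ 2 / (a + c) + sin t ^+ 2 / (b + c)).

Lemma Sigma_normal (R : realType) (a b c : R) (s : bool) (l t : R) :
  Sigma a b c s l t =
  vec3 ((a - l) * normal_x a c t) ((b - l) * normal_y b c t)
       ((c + l) * normal_z a b c s t).
Proof.
by rewrite /Sigma; congr vec3; rewrite /normal_x /normal_y /normal_z; ring.
Qed.

Lemma normal_cos (R : realType) (a c t : R) :
  0 < a + c -> (a + c) * normal_x a c t ^+ 2 = cos t ^+ 2.
Proof.
move=> ac; rewrite /normal_x expr_div_n sqr_sqrtr ?ltW // mulrC divfK //.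
by rewrite gt_eqF.
Qed.

Lemma normal_sin (R : realType) (b c t : R) :
  0 < b + c -> (b + c) * normal_y b c t ^+ 2 = sin t ^+ 2.
Proof.
move=> bc; rewrite /normal_y expr_div_n sqr_sqrtr ?ltW // mulrC divfK //.
by rewrite gt_eqF.
Qed.

Lemma param_trig (R : realType) (a b c t : R) : 0 < a + c -> 0 < b + c ->
  b * (a + c) * normal_x a c t ^+ 2 + a * (b + c) * normal_y b c t ^+ 2 =
  b * cos t ^+ 2 + a * sin t ^+ 2.
Proof. by move=> ac bc; rewrite -!mulrA normal_cos // normal_sin. Qed.

Lemma tropic_normal_trig (R : realType) (a b c : R) (s : bool) (t : R) :
  0 < a + c -> 0 < b + c ->
  tropic_normal a b c (normal_x a c t) (normal_y b c t) (normal_z a b c s t).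
Proof.
move=> ac bc; split; first by rewrite normal_cos // normal_sin // cos2Dsin2.
rewrite /normal_z /normal_x /normal_y exprMn sqrr_sign mul1r !expr_div_n.
rewrite (sqr_sqrtr (ltW ac)) (sqr_sqrtr (ltW bc)) sqr_sqrtr //.
by rewrite addr_ge0 // divr_ge0 ?sqr_ge0 ?ltW.
Qed.

(** Equal sines and cosines make sin (u - t) vanish, but it is positive for 0 < u - t < pi. This
    keeps the paths away from their starting point. *)
Lemma trig_inj (R : realType) (t u : R) :
  t < u < t + pi -> cos u = cos t -> sin u = sin t -> False.
Proof.
move=> tu Ec Es; have : 0 < sin (u - t) by apply: sin_gt0_pi; lra.
by rewrite sinB Ec Es mulrC subrr ltxx.
Qed.

Lemma normal_x_inj (R : realType) (a c t u : R) :
  0 < a + c -> normal_x a c u = normal_x a c t -> cos u = cos t.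
Proof. by move=> ac; apply: mulIf; rewrite invr_eq0 sqrtr_eq0 -ltNge. Qed.

Lemma normal_y_inj (R : realType) (b c t u : R) :
  0 < b + c -> normal_y b c u = normal_y b c t -> sin u = sin t.
Proof. by move=> bc; apply: mulIf; rewrite invr_eq0 sqrtr_eq0 -ltNge. Qed.

Lemma normals_neq0 (R : realType) (a b c : R) (s : bool) (t : R) :
  0 < a + c -> 0 < b + c -> cos t != 0 -> sin t != 0 ->
  [/\ normal_x a c t != 0, normal_y b c t != 0 & normal_z a b c s t != 0].
Proof.
move=> ac bc C0 S0; split.
- by rewrite mulf_neq0 // invr_eq0 sqrtr_eq0 -ltNge.
- by rewrite mulf_neq0 // invr_eq0 sqrtr_eq0 -ltNge.
- rewrite mulf_neq0 ?signr_eq0 // sqrtr_eq0 -ltNge.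
  have C2 : 0 < cos t ^+ 2 by rewrite exprn_even_gt0.
  have S2 : 0 < sin t ^+ 2 by rewrite exprn_even_gt0.
  by rewrite addr_gt0 // divr_gt0.
Qed.

Lemma continuous_normals (R : realType) (a b c : R) (s : bool) :
  [/\ continuous (@normal_x R a c), continuous (@normal_y R b c) &
      continuous (@normal_z R a b c s)].
Proof.
have cc : continuous (@cos R) by exact: continuous_cos.
have cs : continuous (@sin R) by exact: continuous_sin.
have sqr_div (f : R -> R) (w : R) :
    continuous f -> continuous (fun u => f u ^+ 2 / w).
  move=> cf u; apply: cvgM; last exact: cvg_cst.
  exact: (continuous_comp (cf u) (@exprn_continuous R 2 (f u))).
split=> u.
- by apply: cvgM; [exact: cc|exact: cvg_cst].
- by apply: cvgM; [exact: cs|exact: cvg_cst].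
- apply: cvgM; first exact: cvg_cst.
  have csum : continuous (fun u => cos u ^+ 2 / (a + c) + sin u ^+ 2 / (b + c)).
    by move=> w; apply: cvgD; exact: sqr_div.
  exact: (continuous_comp (csum u) (@sqrt_continuous R _)).
Qed.

Lemma quadrant_exists (R : realType) (t : R) :
  0 <= t < 2 * pi ->
  exists k : 'I_4, k%:R * (pi / 2) <= t < k.+1%:R * (pi / 2).
Proof.
move=> /andP[t0 t2].
have [t1|t1] := ltP t (1%:R * (pi / 2)).
  by exists (inord 0); rewrite inordK //; apply/andP; split; lra.
have [t3|t3] := ltP t (2%:R * (pi / 2)).
  by exists (inord 1); rewrite inordK //; apply/andP; split; lra.
have [t4|t4] := ltP t (3%:R * (pi / 2)).
  by exists (inord 2); rewrite inordK //; apply/andP; split; lra.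
by exists (inord 3); rewrite inordK //; apply/andP; split; lra.
Qed.

(** * Tangency with the tropic curve and with the cuspidal edge *)

Lemma touches_tropic_component (R : realType) (a b c : R) (s : bool) (t : R) :
  0 < a + c -> 0 < b + c -> b < a -> cos t != 0 -> sin t != 0 ->
  let m := b * cos t ^+ 2 + a * sin t ^+ 2 in
  let p := Sigma a b c s m t in
  touches [set p + r *: vec3 (- normal_x a c t) (- normal_y b c t)
                             (normal_z a b c s t) | r in [set: R]]
          (connected_component (tropic_set a b c m) p) p.
Proof.
move=> A0 B0 ba C0 S0 m p.
have N := tropic_normal_trig _ a b c s _ A0 B0.
have [X0 Y0 Z0] := normals_neq0 _ _ _ _ s _ A0 B0 C0 S0.
have [am bm cm] := tropic_normal_param _ _ _ _ _ _ _ (N t).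
have [am0 bm0 cm0] := tropic_scales_neq0 _ _ _ _ _ _ _ A0 B0 ba X0 Y0 Z0.
rewrite -am -bm -cm param_trig // -/m in am0 bm0 cm0 => {am bm cm}.
have tropic u : tropic_set a b c m (Sigma a b c s m u).
  by rewrite Sigma_normal tropic_setP //; do 3!eexists; split; [exact: N|].
have [M bound] := tropic_quadratic_bound _ _ _ _ _ _ _ A0 B0 ba X0 Y0 Z0 (N t).
rewrite param_trig // -/m in bound.
have [cx cy cz] := continuous_normals _ a b c s.
have cSigma : continuous (fun u => Sigma a b c s m u).
  rewrite (_ : (fun u => _) = fun u => vec3 ((a - m) * normal_x a c u)
    ((b - m) * normal_y b c u) ((c + m) * normal_z a b c s u)); last first.
    by apply/funext => u; rewrite Sigma_normal.
  apply: continuous_vec3 => u; apply: cvgM; try exact: cvg_cst.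
  - exact: cx.
  - exact: cy.
  - exact: cz.
(* The image of the real line under [Sigma a b c s m] is a connected part of the tropic set through
   [p]. *)
have path u : connected_component (tropic_set a b c m) p (Sigma a b c s m u).
  apply: (connected_component_max (B := range (Sigma a b c s m))).
  - by exists t.
  - by move=> _ [w _ <-]; exact: tropic.
  - apply: connected_continuous_connected.
    + by apply/connected_intervalP => ? ? _ _ ? _.
    + exact: continuous_subspaceT.
  - by exists u.
apply: (touches_of_quadratic_bound _ _ _ _ M).
- exact: path.
- apply: (limit_point_path _ _ _ (Sigma a b c s m) _ pi).
    exact: pi_gt0.
    exact: cSigma.
  move=> u tu; split; first exact: path.
  apply/eqP; rewrite !Sigma_normal.
  move=> /vec3_inj[/(mulfI am0)/normal_x_inj-/(_ A0) Ec].
  by move=> /(mulfI bm0)/normal_y_inj-/(_ B0) Es _; exact: (trig_inj _ t u).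
- by apply: contraNneq Z0 => /rowP/(_ 2); rewrite !mxE /= => ->.
(* The bound holds on the whole tropic set, which contains the component. *)
- move=> q /connected_component_sub.
  rewrite tropic_setP // => -[U [V [W [N' ->]]]].
  by rewrite /p Sigma_normal; exact: bound.
Qed.

(** On each generatrix the edge has the parameter of the quadric that contains the generatrix; this
    is why both contacts occur at the same point. *)
Lemma cuspidal_edge_param (R : realType) (a b l t : R) :
  - a - b + 2 * l + (a - b) * cos (2 * t) = 0 <->
  l = b * cos t ^+ 2 + a * sin t ^+ 2.
Proof.
have -> : 2 * t = t *+ 2 by rewrite mulr_natl.
rewrite cos_mulr2n sin2cos2; split=> [E|->]; last by ring.
by lra.
Qed.

Lemma Sigma_cusp (R : realType) (a b c : R) (s : bool) (t : R) :
  0 < a + c -> 0 < b + c ->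
  Sigma a b c s (b * cos t ^+ 2 + a * sin t ^+ 2) t =
  vec3 ((a - b) * (a + c) * normal_x a c t ^+ 3)
       (- (a - b) * (b + c) * normal_y b c t ^+ 3)
       ((a + c) * (b + c) * normal_z a b c s t ^+ 3).
Proof.
move=> A0 B0; have N := tropic_normal_trig _ a b c s t A0 B0.
have [am bm cm] := tropic_normal_param _ _ _ _ _ _ _ N.
rewrite Sigma_normal -(param_trig _ _ _ c) // am bm cm.
by congr vec3; ring.
Qed.

Lemma touches_cuspidal_edge (R : realType) (a b c : R) (s : bool) (t : R)
    (k : 'I_4) :
  0 < a + c -> 0 < b + c -> b < a -> cos t != 0 -> sin t != 0 ->
  k%:R * (pi / 2) <= t < k.+1%:R * (pi / 2) ->
  touches [set Sigma a b c s (b * cos t ^+ 2 + a * sin t ^+ 2) t +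
               r *: vec3 (- normal_x a c t) (- normal_y b c t)
                         (normal_z a b c s t) | r in [set: R]]
          (cuspidal_edge a b c s k)
          (Sigma a b c s (b * cos t ^+ 2 + a * sin t ^+ 2) t).
Proof.
move=> A0 B0 ba C0 S0 /andP[kt tk].
pose m u := b * cos u ^+ 2 + a * sin u ^+ 2; rewrite -/(m t).
have N := tropic_normal_trig _ a b c s _ A0 B0.
have [X0 Y0 Z0] := normals_neq0 _ _ _ _ s _ A0 B0 C0 S0.
have [M bound] := edge_quadratic_bound _ _ _ _ _ _ _ A0 B0 ba X0 Y0 Z0 (N t).
have edge u : t <= u < k.+1%:R * (pi / 2) ->
    cuspidal_edge a b c s k (Sigma a b c s (m u) u).
  move=> tu; exists (m u), u; split=> //; last by apply/cuspidal_edge_param.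
    have := cos2Dsin2 u; have := sqr_ge0 (cos u); have := sqr_ge0 (sin u).
    rewrite /m; move: (cos u ^+ 2) (sin u ^+ 2) => x y *.
    by apply/andP; split; nra.
  by apply/andP; split; lra.
have [cx cy cz] := continuous_normals _ a b c s.
have cSigma : continuous (fun u => Sigma a b c s (m u) u).
  rewrite (_ : (fun u => _) = fun u => vec3
    ((a - b) * (a + c) * normal_x a c u ^+ 3)
    (- (a - b) * (b + c) * normal_y b c u ^+ 3)
    ((a + c) * (b + c) * normal_z a b c s u ^+ 3)); last first.
    by apply/funext => u; rewrite Sigma_cusp.
  have cube (f : R -> R) (w : R) :
      continuous f -> continuous (fun u => w * f u ^+ 3).
    move=> cf u; apply: cvgM; first exact: cvg_cst.
    exact: (continuous_comp (cf u) (@exprn_continuous R 3 (f u))).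
  by apply: continuous_vec3; exact: cube.
apply: (touches_of_quadratic_bound _ _ _ _ M).
- by apply: edge; rewrite lexx.
- apply: (limit_point_path _ _ _ (fun u => Sigma a b c s (m u) u) _
    (k.+1%:R * (pi / 2) - t)); [by rewrite subr_gt0|exact: cSigma|].
  move=> u; rewrite addrC subrK => /andP[tu uk]; split.
    by apply: edge; rewrite ltW.
  (* With equal cubes, [cube_dist_ge] gives x^2 |y - x| <= 0. *)
  have cube_inj (w x y : R) :
      w * x ^+ 2 != 0 -> w * y ^+ 3 = w * x ^+ 3 -> y = x.
    rewrite mulf_eq0 negb_or => /andP[w0 x0] /(mulfI w0) E.
    have := cube_dist_ge _ x y; rewrite E subrr normr0 mulr0.
    by rewrite pmulr_rle0 ?lt0r ?x0 ?sqr_ge0 // normr_le0 subr_eq0 => /eqP.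
  have [x0 y0 _] := tropic_scales_neq0 _ _ _ _ _ _ _ A0 B0 ba X0 Y0 Z0.
  apply/eqP; rewrite !Sigma_cusp // => /vec3_inj[/cube_inj Ex /cube_inj Ey _].
  have Ec := normal_x_inj _ _ _ _ _ A0 (Ex x0).
  have Es := normal_y_inj _ _ _ _ _ B0 (Ey y0).
  apply: (trig_inj _ t u _ Ec Es).
  (* A quadrant has length pi / 2, so [u] stays below t + pi. *)
  by rewrite tu /=; move: uk kt; rewrite -natr1; have := pi_gt0 R; nra.
- by apply: contraNneq Z0 => /rowP/(_ 2); rewrite !mxE /= => ->.
- move=> q [l [u [_ _ /cuspidal_edge_param -> // ->]]].
  by rewrite !Sigma_cusp //; exact: bound.
Qed.

(** * Generatrices in the quadrics, and the conclusion *)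

Lemma generatrix_in_confocal (R : realType) (a b c : R) (s : bool) (t m : R) :
  0 < a + c -> 0 < b + c -> a - m != 0 -> b - m != 0 -> c + m != 0 ->
  generatrix a b c s t `<=` confocal a b c m <->
  m = b * cos t ^+ 2 + a * sin t ^+ 2.
Proof.
move=> A0 B0 am bm cm.
have E l : confocal_fun a b c m (Sigma a b c s l t) =
    1 + (l - m) ^+ 2 * (b * cos t ^+ 2 + a * sin t ^+ 2 - m) /
    ((a - m) * (b - m) * (c + m)).
  rewrite Sigma_normal confocal_on_line //; last exact: tropic_normal_trig.
  by rewrite param_trig.
split=> [sub|mE]; last first.
  by move=> _ [l _ <-]; rewrite /confocal /= E -mE subrr mulr0 mul0r addr0.
(* At l = m + 1 the factor (l - m)^2 is 1, so one point off the double root suffices to read off the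
   coefficient. *)
have : confocal_fun a b c m (Sigma a b c s (m + 1) t) = 1.
  by apply: sub; exists (m + 1).
rewrite E [m + 1]addrC addrK expr1n mul1r => /eqP.
rewrite -subr_eq0 addrC addKr mulf_eq0 invr_eq0 !mulf_eq0.
by rewrite (negbTE am) (negbTE bm) (negbTE cm) !orbF subr_eq0 => /eqP.
Qed.

Lemma generatrix_line (R : realType) (a b c : R) (s : bool) (t m : R) :
  generatrix a b c s t = [set Sigma a b c s m t +
    r *: vec3 (- normal_x a c t) (- normal_y b c t) (normal_z a b c s t)
    | r in [set: R]].
Proof.
apply/seteqP; split=> _ [r _ <-].
  exists (r - m) => //; rewrite !Sigma_normal vec3_scale vec3_add.
  by congr vec3; ring.
exists (m + r) => //; rewrite !Sigma_normal vec3_scale vec3_add.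
by congr vec3; ring.
Qed.

Theorem proposition4p9 (R : realType) (a b c : R)
  (hb : 0 < b) (hab : b < a) (hc : 0 < c)
  (s : bool) (t : R) (ht : 0 <= t < 2 * pi)
  (hcos : cos t != 0) (hsin : sin t != 0) :
  (exists! l : R,
     hyperboloid_y a b l /\ generatrix a b c s t `<=` confocal a b c l) /\
  (forall l : R,
     hyperboloid_y a b l -> generatrix a b c s t `<=` confocal a b c l ->
     exists (p : 'rV[R]_3) (K : set 'rV[R]_3) (k : 'I_4),
       [/\ tropic_curve a b c l K,
           touches (generatrix a b c s t) K p
         & touches (generatrix a b c s t) (cuspidal_edge a b c s k) p]).
Proof.
have A0 : 0 < a + c by lra.
have B0 : 0 < b + c by lra.
have param l : hyperboloid_y a b l ->
    generatrix a b c s t `<=` confocal a b c l <->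
    l = b * cos t ^+ 2 + a * sin t ^+ 2.
  by move=> /andP[bl la]; apply: generatrix_in_confocal => //; lra.
have hyp : hyperboloid_y a b (b * cos t ^+ 2 + a * sin t ^+ 2).
  have [X0 Y0 _] := normals_neq0 _ _ _ _ s _ A0 B0 hcos hsin.
  have N := tropic_normal_trig _ a b c s t A0 B0.
  have := tropic_normal_param_bounds _ _ _ _ _ _ _ A0 B0 hab X0 Y0 N.
  by rewrite param_trig.
split.
  exists (b * cos t ^+ 2 + a * sin t ^+ 2); split.
    by split=> //; apply/param.
  by move=> l [hl /param ->].
move=> l hl /param -> //.
(* The quadrant is open on the right, which leaves room to follow the edge beyond [t]. *)
have [k kt] := quadrant_exists _ _ ht.
have tr := touches_tropic_component _ _ _ _ s _ A0 B0 hab hcos hsin.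
have ed := touches_cuspidal_edge _ _ _ _ s _ _ A0 B0 hab hcos hsin kt.
set m := b * cos t ^+ 2 + a * sin t ^+ 2 in tr ed *.
exists (Sigma a b c s m t).
exists (connected_component (tropic_set a b c m) (Sigma a b c s m t)), k.
rewrite (generatrix_line _ _ _ _ _ _ m); split=> //.
exists (Sigma a b c s m t) => //.
by have [/connected_component_sub] := tr.
Qed.
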